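(* The operator $W:S^{2,2}\to S^{2,2}$ has a unique fixed point, namely $s_0=\left(\frac12,0,\frac12,0\right)$; this fixed point is nonhyperbolic; and for every initial point $s\in S^{2,2}$, $$\lim_{m\to\infty}W^{m}(s)=s_0=\left(\tfrac12,0,\tfrac12,0\right).$$
   Context: Let $S^{3}=\{(x,y,u,v)\in\mathbb{R}^4:\ x\ge 0,\ y\ge 0,\ u\ge 0,\ v\ge 0,\ x+y+u+v=1\}$, let $\Theta=\{(x,y,u,v)\in S^{3}:\ (x,y)=(0,0)\ \text{or}\ (u,v)=(0,0)\}$, and let $S^{2,2}=S^{3}\setminus\Theta$. The operator $W:S^{2,2}\to S^{2,2}$ is $W(x,y,u,v)=(x',y',u',v')$ with $$x'=\frac{2xu+yu}{4(x+y)(u+v)},\quad y'=\frac{6xv+3yu+4yv}{12(x+y)(u+v)},$$ $$u'=\frac{6xu+6xv+3yu+4yv}{12(x+y)(u+v)},\quad v'=\frac{3yu+4yv}{12(x+y)(u+v)}.$$ $W^m$ denotes the $m$-fold composition of $W$ with itself ($W^0$ is the identity). A fixed point of an operator is called hyperbolic if the Jacobian of the operator at that point has no eigenvalues on the unit circle, and nonhyperbolic otherwise; here the Jacobian of $W$ is computed from the formulas above. *)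

(* Defs.v *)
From HB Require Import structures.
From mathcomp Require Import all_boot all_order all_algebra.
From mathcomp Require Import complex.
From mathcomp Require Import all_classical all_reals all_analysis.

Set Implicit Arguments.
Unset Strict Implicit.
Unset Printing Implicit Defensive.

Import Order.TTheory GRing.Theory Num.Theory.
Import numFieldNormedType.Exports.

Local Open Scope classical_set_scope.
Local Open Scope ring_scope.

(* A point (x, y, u, v) of R^4 is a row vector, indexed by 'I_4 = {0,1,2,3}. *)
Definition row4 (R : realType) (x y u v : R) : 'rV[R]_4 :=
  \row_(j < 4) [:: x; y; u; v]`_j.

Definition simplex3 (R : realType) : set 'rV[R]_4 :=
  [set s | (forall j, 0 <= s 0 j) /\ \sum_j s 0 j = 1].

Definition Theta (R : realType) : set 'rV[R]_4 :=
  [set s | simplex3 s /\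
    ((s 0 0, s 0 1) = (0, 0) \/ (s 0 2, s 0 3) = (0, 0))].

Definition S22 (R : realType) : set 'rV[R]_4 := @simplex3 R `\` @Theta R.

(* The formulas are taken on all of R^4, so that W can be differentiated
   there. The denominators vanish only where x + y = 0 or u + v = 0, hence
   nowhere on S22. *)
Definition W (R : realType) (s : 'rV[R]_4) : 'rV[R]_4 :=
  let x := s 0 0 in let y := s 0 1 in
  let u := s 0 2 in let v := s 0 3 in
  row4
    ((2 * x * u + y * u) / (4 * (x + y) * (u + v)))
    ((6 * x * v + 3 * y * u + 4 * y * v) / (12 * (x + y) * (u + v)))
    ((6 * x * u + 6 * x * v + 3 * y * u + 4 * y * v)
       / (12 * (x + y) * (u + v)))
    ((3 * y * u + 4 * y * v) / (12 * (x + y) * (u + v))).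

Definition s0 (R : realType) : 'rV[R]_4 := row4 (1 / 2) 0 (1 / 2) 0.

(* Eigenvalues are complex. 'J f p acts on row vectors ('d f p h = h *m 'J f p),
   which matches the left-eigenvector convention of [eigenvalue]. For f not
   differentiable at p, 'J f p is meaningless. *)
Definition hyperbolic (R : realType) n (f : 'rV[R]_n -> 'rV[R]_n)
    (p : 'rV[R]_n) : Prop :=
  forall l : R[i],
    eigenvalue (map_mx (real_complex R) ('J f p)) l -> `|l| <> 1.

Definition nonhyperbolic (R : realType) n (f : 'rV[R]_n -> 'rV[R]_n)
    (p : 'rV[R]_n) : Prop := ~ hyperbolic f p.

(* Main.v *)
(* On S22 the image W s depends only on b = y / (x + y) and d = v / (u + v),
   which evolve by
     b' = (3b + 6d - 5bd) / (6 - 2bd),   d' = (3b + bd) / (6 + 2bd).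
   Along an orbit b + d decreases by at least bd / 3 at each step, so it
   converges and bd tends to 0. Since b' >= b/2 and d' >= b/2, b^2 <= 4 b' d'
   tends to 0 too, and d' <= b gives d -> 0; this forces W^m(s) -> s0. A fixed
   point is the limit of its own orbit, whence uniqueness. The linearization
   of (b, d) at 0 has eigenvalues 1 and -1/2, so s0 is nonhyperbolic. *)
Require Import Defs.
From mathcomp Require Import all_boot all_order all_algebra.
From mathcomp Require Import complex ring lra.
From mathcomp Require Import all_classical all_reals all_analysis.

Import Order.TTheory GRing.Theory Num.Theory.
Import numFieldNormedType.Exports.

Local Open Scope classical_set_scope.
Local Open Scope ring_scope.

(** * Row vectors with four real coordinates *)

Section Row4.
Context {R : realType}.
Implicit Types x y u v : R.

Lemma row4_0 x y u v : row4 x y u v 0 0 = x. Proof. by rewrite mxE. Qed.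
Lemma row4_1 x y u v : row4 x y u v 0 1 = y. Proof. by rewrite mxE. Qed.
Lemma row4_2 x y u v : row4 x y u v 0 2 = u. Proof. by rewrite mxE. Qed.
Lemma row4_3 x y u v : row4 x y u v 0 3 = v. Proof. by rewrite mxE. Qed.
Definition row4E := (row4_0, row4_1, row4_2, row4_3).

Lemma ord4P (P : 'I_4 -> Prop) : P 0 -> P 1 -> P 2 -> P 3 -> forall j, P j.
Proof.
by move=> P0 P1 P2 P3; case; case=> [|[|[|[|//]]]] lt_j4;
  [move: P0 | move: P1 | move: P2 | move: P3]; congr P; apply: val_inj.
Qed.

Lemma row4P (s t : 'rV[R]_4) : s 0 0 = t 0 0 -> s 0 1 = t 0 1 ->
  s 0 2 = t 0 2 -> s 0 3 = t 0 3 -> s = t.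
Proof. by move=> e0 e1 e2 e3; apply/rowP; apply: ord4P. Qed.

Lemma sum_ord4 (F : 'I_4 -> R) : \sum_j F j = F 0 + F 1 + F 2 + F 3.
Proof.
rewrite !big_ord_recl big_ord0 addr0 !addrA.
by congr (_ + _ + _ + _); congr F; apply: val_inj.
Qed.

(** Reduces limits and differentiability of a [row4] of functions to those of its four scalar
    entries. *)
Lemma row4_delta x y u v : row4 x y u v =
  x *: row4 1 0 0 0 + y *: row4 0 1 0 0 + u *: row4 0 0 1 0 + v *: row4 0 0 0 1.
Proof.
by apply: row4P; rewrite ![(_ + _ : 'rV__) _ _]mxE
  ![(_ *: _ : 'rV__) _ _]mxE !row4E; ring.
Qed.

Lemma cvg_row4 (T : Type) (F : set_system T) (FF : Filter F)
    (f g h k : T -> R) x y u v :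
  f t @[t --> F] --> x -> g t @[t --> F] --> y ->
  h t @[t --> F] --> u -> k t @[t --> F] --> v ->
  row4 (f t) (g t) (h t) (k t) @[t --> F] --> row4 x y u v.
Proof.
move=> fx gy hu kv; rewrite (row4_delta x).
under eq_fun do rewrite row4_delta.
by apply: cvgD; [apply: cvgD; [apply: cvgD|]|]; apply: cvgZr_tmp.
Qed.

Lemma differentiable_row4 (V : normedModType R) (f g h k : V -> R) p :
  differentiable f p -> differentiable g p ->
  differentiable h p -> differentiable k p ->
  differentiable (fun q => row4 (f q) (g q) (h q) (k q)) p.
Proof.
move=> df dg dh dk; under eq_fun do rewrite row4_delta.
by do 3?[apply: differentiableD]; apply: differentiableZl.
Qed.

End Row4.

(** * The operator in the ratios [fracy] and [fracv] *)

Section Operator.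
Context {R : realType}.
Implicit Types (s : 'rV[R]_4) (b d : R).

(** A pair of nonnegative numbers is (0, 0) exactly when its sum vanishes, so avoiding [Theta] makes
    both sums positive. *)
Lemma S22P s : S22 s <->
  [/\ [/\ 0 <= s 0 0, 0 <= s 0 1, 0 <= s 0 2 & 0 <= s 0 3],
      s 0 0 + s 0 1 + s 0 2 + s 0 3 = 1, 0 < s 0 0 + s 0 1
    & 0 < s 0 2 + s 0 3].
Proof.
split=> [[[s_ge0 s1] nTheta]|[[x0 y0 u0 v0] s1 xy uv]].
  have [x0 y0 u0 v0] := And4 (s_ge0 0) (s_ge0 1) (s_ge0 2) (s_ge0 3).
  rewrite sum_ord4 in s1; split=> //; rewrite lt0r addr_ge0 // andbT.
    apply/negP => /eqP xy; apply: nTheta; split.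
      by split=> //; rewrite sum_ord4.
    by left; congr (_, _); lra.
  apply/negP => /eqP uv; apply: nTheta; split.
    by split=> //; rewrite sum_ord4.
  by right; congr (_, _); lra.
split; first by split; [apply: ord4P | rewrite sum_ord4].
by move=> [_ [[x y]|[u v]]]; lra.
Qed.

Definition fracy s : R := s 0 1 / (s 0 0 + s 0 1).
Definition fracv s : R := s 0 3 / (s 0 2 + s 0 3).

Lemma frac_bounds s : S22 s -> 0 <= fracy s <= 1 /\ 0 <= fracv s <= 1.
Proof.
move=> /S22P[[x0 y0 u0 v0] _ xy uv].
by rewrite /fracy /fracv !divr_ge0 ?ler_pdivrMr ?mul1r ?(ltW xy) ?(ltW uv) //;
  split; lra.
Qed.

(** Each numerator of [W] is bilinear in (x, y) and (u, v); dividing by (x + y)(u + v) turns these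
    pairs into (1 - b, b) and (1 - d, d). *)
Lemma W_frac s : S22 s ->
  let b := fracy s in let d := fracv s in
  W s = row4 ((2 - b) * (1 - d) / 4) ((3 * b + 6 * d - 5 * (b * d)) / 12)
    ((6 - 3 * b + b * d) / 12) ((3 * b + b * d) / 12).
Proof.
move=> /S22P[_ _ xy uv]; have [xy0 uv0] := (lt0r_neq0 xy, lt0r_neq0 uv).
by congr row4; rewrite /fracy /fracv; field; rewrite xy0 uv0.
Qed.

Lemma S22_W s : S22 s -> S22 (W s).
Proof.
move=> Ss; have [/andP[b0 b1] /andP[d0 d1]] := frac_bounds s Ss.
rewrite (W_frac _ Ss); set b := fracy s in b0 b1 *; set d := fracv s in d0 d1 *.
by apply/S22P; rewrite !row4E; split; [split| | |]; nra.
Qed.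

(** By [W_frac], the new pair sums x' + y' and u' + v' are (6 - 2bd) / 12 and (6 + 2bd) / 12. *)
Lemma frac_W s : S22 s ->
  let b := fracy s in let d := fracv s in
  fracy (W s) = (3 * b + 6 * d - 5 * (b * d)) / (6 - 2 * (b * d)) /\
  fracv (W s) = (3 * b + b * d) / (6 + 2 * (b * d)).
Proof.
move=> Ss; have [/andP[b0 b1] /andP[d0 d1]] := frac_bounds s Ss.
rewrite (W_frac _ Ss); set b := fracy s in b0 b1 *; set d := fracv s in d0 d1 *.
by rewrite /fracy /fracv !row4E; split; field;
  do ?[apply/andP; split]; apply: lt0r_neq0; nra.
Qed.

(* b + d is a first integral of the linearization at b = d = 0. *)
Lemma frac_decrease b d : 0 <= b <= 1 -> 0 <= d <= 1 ->
  let b' := (3 * b + 6 * d - 5 * (b * d)) / (6 - 2 * (b * d)) in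
  let d' := (3 * b + b * d) / (6 + 2 * (b * d)) in
  [/\ b * d / 3 <= b + d - (b' + d'), b / 2 <= b', b / 2 <= d' & d' <= b].
Proof.
move=> /andP[b0 b1] /andP[d0 d1] b' d'.
have bd0 : 0 <= b * d by rewrite mulr_ge0.
have bd1 : b * d <= 1 by rewrite mulr_ile1.
have p : 0 < 6 - 2 * (b * d) by lra.
have q : 0 < 6 + 2 * (b * d) by lra.
split.
- have -> : b' + d' = (b + d) - b * d *
     (24 - 12 * d + 12 * (b * d) - 4 * (b * d) * (b + d)) /
     ((6 - 2 * (b * d)) * (6 + 2 * (b * d))).
    by rewrite /b' /d'; field; rewrite !lt0r_neq0.
  rewrite opprB addrC subrK -!mulrA !ler_wpM2l //.
  (* The quotient is at least 12 / 36: the denominator is at most 36, and the numerator is at least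
     12 because d <= 1 and b + d <= 2. *)
  by rewrite ler_pdivlMr ?mulr_gt0 //; nra.
- by rewrite ler_pdivlMr //; nra.
- by rewrite ler_pdivlMr //; nra.
- by rewrite ler_pdivrMr //; nra.
Qed.

(** * The fixed point and the limit of orbits *)

Lemma S22_s0 : S22 (s0 R).
Proof. by apply/S22P; rewrite !row4E; split; [split| | |]; lra. Qed.

Lemma W_s0 : W (s0 R) = s0 R.
Proof. by rewrite /W /s0 !row4E; congr row4; field. Qed.

Lemma S22_iter s m : S22 s -> S22 (iter m (@W R) s).
Proof. by move=> Ss; elim: m => //= m; apply: S22_W. Qed.

Lemma cvg_frac s : S22 s ->
  fracy (iter m (@W R) s) @[m --> \oo] --> (0 : R) /\
  fracv (iter m (@W R) s) @[m --> \oo] --> (0 : R).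
Proof.
move=> Ss.
set b : R ^nat := fun m => fracy (iter m (@W R) s).
set d : R ^nat := fun m => fracv (iter m (@W R) s).
have bd m : 0 <= b m <= 1 /\ 0 <= d m <= 1 by apply/frac_bounds/S22_iter.
have step m : [/\ b m * d m / 3 <= b m + d m - (b m.+1 + d m.+1),
    b m / 2 <= b m.+1, b m / 2 <= d m.+1 & d m.+1 <= b m].
  have [b'E d'E] := frac_W _ (S22_iter s m Ss).
  rewrite (b'E : b m.+1 = _) (d'E : d m.+1 = _).
  by have [] := bd m; apply: frac_decrease.
pose L : R ^nat := fun m => b m + d m.
have cvgL : cvgn L.
  apply: nonincreasing_is_cvgn.
    apply/nonincreasing_seqP => m; rewrite /L.
    by have [/andP[b0 _] /andP[d0 _]] := bd m; have [+ _ _ _] := step m; nra.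
  exists 0 => _ [m _ <-]; rewrite /L.
  by have [/andP[b0 _] /andP[d0 _]] := bd m; rewrite addr_ge0.
have cvgdL : L m - L m.+1 @[m --> \oo] --> (0 : R).
  rewrite -(subrr (limn L)); apply: cvgB => //.
  by rewrite (cvg_shiftS L).
(* The bound comes from b_m^2 <= 4 b_(m+1) d_(m+1), where the product is at most three times the
   decrease of [L] at step m + 1. *)
have cvgdL2 : 12 * (L m.+1 - L m.+2) @[m --> \oo] --> (0 : R).
  rewrite -(mulr0 12); apply: cvgMr.
  by rewrite (cvg_shiftS (fun m => L m - L m.+1)).
have cvgb2 : b m ^+ 2 @[m --> \oo] --> (0 : R).
  apply: (squeeze_cvgr _ (cvg_cst 0) cvgdL2); near=> m.
  have [/andP[b0 _] _] := bd m; have [_ b' d' _] := step m.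
  by have [bd' _ _ _] := step m.+1; rewrite /L sqr_ge0 /=; nra.
have cvgb : b m @[m --> \oo] --> (0 : R).
  rewrite -(sqrtr0 R).
  under eq_fun do rewrite -(ger0_norm (andP (bd _).1).1) -sqrtr_sqr.
  by apply: continuous_cvg cvgb2; exact: sqrt_continuous.
split=> //; rewrite -/d -cvg_shiftS.
apply: (squeeze_cvgr _ (cvg_cst 0) cvgb); near=> m.
by have [_ /andP[-> _]] := bd m.+1; have [] := step m.
Unshelve. all: by end_near.
Qed.

Lemma cvg_iterW s : S22 s -> iter m (@W R) s @[m --> \oo] --> s0 R.
Proof.
move=> Ss; rewrite -cvg_shiftS /=.
under eq_fun do rewrite (W_frac _ (S22_iter s _ Ss)).
have [b0 d0] := cvg_frac s Ss.
have bd0 : fracy (iter m (@W R) s) * fracv (iter m (@W R) s) @[m --> \oo]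
    --> (0 : R) by rewrite -(mulr0 0); apply: cvgM.
(* The formulas of [W_frac] at b = d = 0, left unevaluated so that the limit rules apply term by
   term. *)
have -> : s0 R = row4 ((2 - 0) * (1 - 0) / 4) ((3 * 0 + 6 * 0 - 5 * 0) / 12)
  ((6 - 3 * 0 + 0) / 12) ((3 * 0 + 0) / 12) by congr row4; field.
apply: cvg_row4; repeat first [exact: cvg_cst | assumption | apply: cvgD
  | apply: cvgN | apply: cvgM].
Qed.

(** * Linearization at the fixed point *)

Lemma differentiable_W s :
  s 0 0 + s 0 1 != 0 -> s 0 2 + s 0 3 != 0 -> differentiable (@W R) s.
Proof.
move=> xy uv.
apply: differentiable_row4; apply: differentiableM;
  repeat first [exact: differentiable_cst | exact: differentiable_coord
    | apply: differentiableD | apply: differentiableM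
    | apply: differentiableV => //=; last by rewrite !mulf_neq0].
Qed.

(* (-2, 2, -1, 1) lies over the direction (4, 2) in the (b, d)-plane, which the
   linearization of the (b, d)-map fixes. *)
Lemma derive_W_s0 :
  'D_(row4 (-2) 2 (-1) 1) (@W R) (s0 R) = row4 (-2) 2 (-1) 1.
Proof.
(* Along this direction x + y and u + v stay equal to 1/2, so the denominators are constant and [W]
   is quadratic in t; [k] is its t^2 coefficient. *)
pose k : 'rV[R]_4 := row4 2 (- (10 / 3)) (2 / 3) (2 / 3).
set h := row4 _ _ _ _.
have Wh t : W (t *: h + s0 R) = s0 R + t *: h + t ^+ 2 *: k.
  apply: row4P; rewrite ![(_ + _ : 'rV__) _ _]mxE
    ![(_ *: _ : 'rV__) _ _]mxE /W !row4E ![(_ + _ : 'rV__) _ _]mxE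
    ![(_ *: _ : 'rV__) _ _]mxE !row4E; field;
    do ?[apply/andP; split]; apply/eqP; lra.
apply: (cvg_lim (@norm_hausdorff _ _)).
have : h + t *: k @[t --> 0^'] --> h.
  rewrite -[X in _ --> X]addr0 -(scale0r k); apply: cvgD; first exact: cvg_cst.
  by apply: cvgZr_tmp; apply: cvg_within.
apply: cvg_trans; apply: near_eq_cvg; near=> t.
have t0 : t != 0 by near: t; exact: nbhs_dnbhs_neq.
rewrite /= Wh W_s0 [_ - s0 R]addrC !addrA addNr add0r scalerDr !scalerA mulVf // scale1r.
by rewrite expr2 mulKf.
Unshelve. all: by end_near.
Qed.

(** The direction of [derive_W_s0] is a real eigenvector of the Jacobian for the eigenvalue 1, which
    remains an eigenvalue over the complex numbers. *)
Lemma nonhyperbolic_W_s0 : nonhyperbolic (@W R) (s0 R).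
Proof.
move=> /(_ 1); apply; last exact: normr1.
rewrite -(rmorph1 (real_complex R)) eigenvalue_map.
apply/eigenvalueP; exists (row4 (-2) 2 (-1) 1).
  rewrite -deriveEjacobian ?derive_W_s0 ?scale1r //.
  by apply: differentiable_W; rewrite !row4E; apply: lt0r_neq0; lra.
apply/eqP => /rowP/(_ 1); rewrite row4E mxE => /eqP.
by rewrite pnatr_eq0.
Qed.

End Operator.

Theorem theorem2p1 (R : realType) :
  [/\ set_fun (@S22 R) (@S22 R) (@W R),
      [set s | S22 s /\ W s = s] = [set s0 R],
      differentiable (@W R) (s0 R) /\ nonhyperbolic (@W R) (s0 R)
    & forall s : 'rV[R]_4, S22 s -> iter m (@W R) s @[m --> \oo] --> s0 R].
Proof.
split.
- by move=> s; apply: S22_W.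
- apply/seteqP; split=> [s [Ss Ws]|_ ->] /=; last first.
    by split; [exact: S22_s0 | exact: W_s0].
  have := cvg_iterW s Ss.
  have -> : (fun m => iter m (@W R) s) = fun=> s.
    by apply/funext; elim=> //= m ->.
  move=> /(cvg_lim (@norm_hausdorff _ _)) <-.
  by rewrite lim_cst.
- split; last exact: nonhyperbolic_W_s0.
  by apply: differentiable_W; rewrite !row4E; apply: lt0r_neq0; lra.
- exact: cvg_iterW.
Qed.
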